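(* For each guarded recursive specification $E$ over pACPpSI and each $X\in\mathrm{vars}(E)$, there exists a guarded recursive specification $E'$ over pACP such that the equation $\langle X|E\rangle=\langle X|E'\rangle$ is derivable from the axioms of pACPpSIr.
   Context: Meadow and probabilities. Fix a signed cancellation meadow $M$: a commutative ring with identity $1$ equipped with a total unary operation $x^{-1}$ satisfying $(x^{-1})^{-1}=x$ and $x\cdot(x\cdot x^{-1})=x$ (so $0^{-1}=0$), satisfying the cancellation axiom $x\neq0\wedge x\cdot y=x\cdot z\Rightarrow y=z$, expanded with a signum operation $\mathrm{s}$ satisfying $\mathrm{s}(x/x)=x/x$, $\mathrm{s}(1-x/x)=1-x/x$, $\mathrm{s}(-1)=-1$, $\mathrm{s}(x^{-1})=\mathrm{s}(x)$, $\mathrm{s}(xy)=\mathrm{s}(x)\mathrm{s}(y)$, $\bigl(1-\frac{\mathrm{s}(x)-\mathrm{s}(y)}{\mathrm{s}(x)-\mathrm{s}(y)}\bigr)(\mathrm{s}(x+y)-\mathrm{s}(x))=0$, with $x/y=x\cdot y^{-1}$. $\mathrm{Prob}=\{\pi\in M:\mathrm{s}(\mathrm{s}(\pi)+1)\cdot\mathrm{s}(\mathrm{s}(1-\pi)+1)=1\}$. Actions: a set $A$, $\delta\notin A$, $A_\delta=A\cup\{\delta\}$, and a commutative associative $\gamma:A_\delta\times A_\delta\to A_\delta$ with $\gamma(\delta,a)=\delta$. pACP: terms built from variables in a countably infinite set $\mathcal X$, constants $a$ ($a\in A$) and $\delta$, binary operators $+$, $\cdot$, $\oplus_\pi$ ($\pi\in\mathrm{Prob}$),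 $\parallel$, $\lfloor\!\lfloor$ (left merge), $\mid$ (communication merge), unary $\partial_H$ ($H\subseteq A$). Axioms ($a,b$ range over $A\cup\{\delta\}$ as constants, $\gamma(a,b)$ is the constant for that element, $H\subseteq A$, $\pi,\rho\in\mathrm{Prob}$): A1 $x+y=y+x$; A2 $(x+y)+z=x+(y+z)$; A3' $a+a=a$; A4 $(x+y)\cdot z=x\cdot z+y\cdot z$; A5 $(x\cdot y)\cdot z=x\cdot(y\cdot z)$; A6 $x+\delta=x$; A7 $\delta\cdot x=\delta$; D1 $\partial_H(a)=a$ if $a\notin H$; D2 $\partial_H(a)=\delta$ if $a\in H$; D3 $\partial_H(x+y)=\partial_H(x)+\partial_H(y)$; D4 $\partial_H(x\cdot y)=\partial_H(x)\cdot\partial_H(y)$; pA1 $x\oplus_\pi y=y\oplus_{1-\pi}x$; pA2 $(x\oplus_\pi y)\oplus_\rho z=x\oplus_{\pi\rho}(y\oplus_{\frac{(1-\pi)\rho}{1-\pi\rho}}z)$; pA3 $x\oplus_\pi x=x$; pA4 $(x\oplus_\pi y)\cdot z=x\cdot z\oplus_\pi y\cdot z$; pA5 $(x\oplus_\pi y)+z=(x+z)\oplus_\pi(y+z)$; pA6 $x\oplus_1y=x$; CM1' $x=x+x\wedge y=y+y\Rightarrow x\parallel y=x\lfloor\!\lfloor y+y\lfloor\!\lfloor x+x\mid y$; CM2 $a\lfloor\!\lfloor x=a\cdot x$; CM3 $a\cdot x\lfloor\!\lfloor y=a\cdot(x\parallel y)$; CM4 $(x+y)\lfloor\!\lfloor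 z=x\lfloor\!\lfloor z+y\lfloor\!\lfloor z$; CM5 $a\cdot x\mid b=\gamma(a,b)\cdot x$; CM6 $a\mid b\cdot x=\gamma(a,b)\cdot x$; CM7 $a\cdot x\mid b\cdot y=\gamma(a,b)\cdot(x\parallel y)$; CM8 $(x+y)\mid z=x\mid z+y\mid z$; CM9 $x\mid(y+z)=x\mid y+x\mid z$; CM10 $\delta\mid x=\delta$; CM11 $x\mid\delta=\delta$; CM12 $a\mid b=\gamma(a,b)$; pCM1 $(x\oplus_\pi y)\parallel z=(x\parallel z)\oplus_\pi(y\parallel z)$; pCM2 $x\parallel(y\oplus_\pi z)=(x\parallel y)\oplus_\pi(x\parallel z)$; pCM3 $(x\oplus_\pi y)\lfloor\!\lfloor z=(x\lfloor\!\lfloor z)\oplus_\pi(y\lfloor\!\lfloor z)$; pCM4 $x\lfloor\!\lfloor(y\oplus_\pi z)=(x\lfloor\!\lfloor y)\oplus_\pi(x\lfloor\!\lfloor z)$; pCM5 $(x\oplus_\pi y)\mid z=(x\mid z)\oplus_\pi(y\mid z)$; pCM6 $x\mid(y\oplus_\pi z)=(x\mid y)\oplus_\pi(x\mid z)$; pD $\partial_H(x\oplus_\pi y)=\partial_H(x)\oplus_\pi\partial_H(y)$. Notation: for $n\ge1$ and $\pi_1,\dots,\pi_n\in\mathrm{Prob}$ summing to $1$, $\bigoplus_{i=1}^{1}[\pi_i]\,t_i=t_1$ and $\bigoplus_{i=1}^{n+1}[\pi_i]\,t_i=t_1\oplus_{\pi_1}\bigl(\bigoplus_{i=1}^{n}[\pi_{i+1}/(1-\pi_1)]\,t_{i+1}\bigr)$.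 $\mathbb N^+$ is the set of positive naturals. For sequences, $\langle\rangle$ is the empty sequence and $h\frown u$ is concatenation. Interleaving histories: for $n\in\mathbb N^+$, $\mathrm{Hist}_n\subseteq(\mathbb N^+\times\mathbb N^+)^*$ is inductively defined by: $\langle\rangle\in\mathrm{Hist}_n$; if $i\le n$ then $\langle i,n\rangle\in\mathrm{Hist}_n$; if $h\frown\langle i,n\rangle\in\mathrm{Hist}_n$, $j\le n$ and $n-1\le m\le n+1$ then $h\frown\langle i,n\rangle\frown\langle j,m\rangle\in\mathrm{Hist}_m$. Interleaving strategy data: a set $S$ (control states); for each $n\in\mathbb N^+$ a partial function $\mathrm{sched}_n:\mathrm{Hist}_n\times S\rightharpoonup(\{1,\dots,n\}\to\mathrm{Prob})$ with $\sum_{i=1}^n\mathrm{sched}_n(h,s)(i)=1$ whenever defined; a total function $\mathrm{updat}_n:\mathrm{Hist}_n\times S\times\{1,\dots,n\}\times A\times\{0,1\}\to S$; a set $C\subset A$ (control actions) with $\mathrm{updat}_n(h,s,i,a,0)=s$ for $a\in A\setminus C$, such that for each $c\in C$ there is $\bar c\in A\setminus C$, and for all $a,b\in A$: $\gamma(a,b)\neq c$, $\gamma(a,b)\neq\bar c$, $\gamma(a,c)=\delta$, $\gamma(a,\bar c)=\delta$. Also a set $D$ of data, actions $\mathrm{pcr}(d),\mathrm{rcr}(d)\in A$ for $d\in D$ with $\gamma(\mathrm{pcr}(d),a)=\delta$ and $\gamma(a,b)\neq\mathrm{pcr}(d)$ for all $a,b\in A$, and a function $\mathrm{crea}$ from $D$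 to the set of closed pACPpSI terms. pACPpSI: the signature of pACP extended with, for each $n\in\mathbb N^+$, $h\in\mathrm{Hist}_n$, $s\in S$, an $n$-ary operator $\|^n_{h,s}$ (strategic interleaving), and for each $i\le n$ an $n$-ary operator $\|^n_{i,h,s}$ (positional strategic interleaving). Its axioms are those of pACP plus the following, where $a$ ranges over constants $a\in A$ not of the form $\mathrm{pcr}(d)$ or $\mathrm{rcr}(d)$, and $d\in D$: SI0': $x_1=x_1+x_1\wedge\dots\wedge x_n=x_n+x_n\Rightarrow\|^n_{h,s}(x_1,\dots,x_n)=\delta$ if $\mathrm{sched}_n(h,s)$ is undefined; SI1': $x_1=x_1+x_1\wedge\dots\wedge x_n=x_n+x_n\Rightarrow\|^n_{h,s}(x_1,\dots,x_n)=\bigoplus_{i=1}^n[\mathrm{sched}_n(h,s)(i)]\,\|^n_{i,h,s}(x_1,\dots,x_n)$ if $\mathrm{sched}_n(h,s)$ is defined; SI2: $\|^n_{i,h,s}(x_1,\dots,x_{i-1},\delta,x_{i+1},\dots,x_n)=\delta$; SI3: $\|^1_{i,h,s}(a)=a$; SI4: $\|^{n+1}_{i,h,s}(x_1,\dots,x_{i-1},a,x_{i+1},\dots,x_{n+1})=a\cdot\|^n_{h\frown\langle i,n\rangle,\mathrm{updat}_{n+1}(h,s,i,a,1)}(x_1,\dots,x_{i-1},x_{i+1},\dots,x_{n+1})$; SI5: $\|^n_{i,h,s}(x_1,\dots,x_{i-1},a\cdot x_i',x_{i+1},\dots,x_n)=a\cdot\|^n_{h\frown\langle i,n\rangle,\mathrm{updat}_n(h,s,i,a,0)}(x_1,\dots,x_{i-1},x_i',x_{i+1},\dots,x_n)$;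 SI6: $\|^n_{i,h,s}(x_1,\dots,x_{i-1},\mathrm{pcr}(d),x_{i+1},\dots,x_n)=\mathrm{rcr}(d)\cdot\|^n_{h\frown\langle i,n\rangle,\mathrm{updat}_n(h,s,i,\mathrm{pcr}(d),1)}(x_1,\dots,x_{i-1},x_{i+1},\dots,x_n,\mathrm{crea}(d))$; SI7: $\|^n_{i,h,s}(x_1,\dots,x_{i-1},\mathrm{pcr}(d)\cdot x_i',x_{i+1},\dots,x_n)=\mathrm{rcr}(d)\cdot\|^{n+1}_{h\frown\langle i,n+1\rangle,\mathrm{updat}_n(h,s,i,\mathrm{pcr}(d),0)}(x_1,\dots,x_{i-1},x_i',x_{i+1},\dots,x_n,\mathrm{crea}(d))$; SI8: $\|^n_{i,h,s}(\dots,x_i'+x_i'',\dots)=\|^n_{i,h,s}(\dots,x_i',\dots)+\|^n_{i,h,s}(\dots,x_i'',\dots)$ (other arguments unchanged); pSI1: $\|^n_{h,s}(\dots,x_i'\oplus_\pi x_i'',\dots)=\|^n_{h,s}(\dots,x_i',\dots)\oplus_\pi\|^n_{h,s}(\dots,x_i'',\dots)$; pSI2: $\|^n_{i,h,s}(\dots,x_i'\oplus_\pi x_i'',\dots)=\|^n_{i,h,s}(\dots,x_i',\dots)\oplus_\pi\|^n_{i,h,s}(\dots,x_i'',\dots)$. Guarded recursion over a theory $T\in\{\text{pACP},\text{pACPpSI}\}$: an occurrence of a variable $X$ in a $T$ term $t$ is guarded if $t$ has a subterm $a\cdot t'$ with $a\in A$ and $t'$ containing that occurrence; $t$ is guarded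 if all its variable occurrences are. A recursive specification over $T$ is a set $E=\{X_i=t_i\mid i\in I\}$ ($I$ finite or countably infinite, distinct $X_i\in\mathcal X$, each $t_i$ a $T$ term with variables among the $X_i$); it is guarded if each $t_i$ can be rewritten to a guarded $T$ term using the axioms of $T$ in either direction and the equations $X_j=t_j$ ($j\neq i$) from left to right. $\mathrm{vars}(E)$ is its set of variables. pACPpSIr extends pACPpSI with a constant $\langle X|E\rangle$ for each guarded recursive specification $E$ over pACPpSI and $X\in\mathrm{vars}(E)$, with axioms RDP: $\langle X|E\rangle=\langle t|E\rangle$ if $X=t\in E$ (where $\langle t|E\rangle$ is $t$ with each $Y\in\mathrm{vars}(E)$ replaced by $\langle Y|E\rangle$), and RSP: $E\Rightarrow X=\langle X|E\rangle$ if $X\in\mathrm{vars}(E)$. Guarded recursive specifications over pACP are in particular over pACPpSI, so their constants are also available. Derivations use infinitary conditional equational logic.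
   Formalization: SI3–SI5 are also taken for the actions rcr(d) (otherwise no axiom determines a positional interleaving whose scheduled process is rcr(d), and the claim fails), and ⟨i,n⟩ is in Hist_n for i ≤ n+1, not only i ≤ n, so that SI4 with empty history and i = n+1 is well formed. *)

(* Defs.v *)
From HB Require Import structures.
From mathcomp Require Import all_boot all_algebra.
From mathcomp Require Import ring zify.

Set Implicit Arguments.
Unset Strict Implicit.
Unset Printing Implicit Defensive.

Import GRing.Theory.
Local Open Scope ring_scope.

(* [1 <> 0] is not required, hence [comPzRingType] rather than
   [comNzRingType]. *)
Record signedMeadow := SignedMeadow {
  meadow_ring :> comPzRingType;
  minv : meadow_ring -> meadow_ring;
  sgn : meadow_ring -> meadow_ring;
  minvK : forall x, minv (minv x) = x;
  mulmV : forall x : meadow_ring, x * (x * minv x) = x;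
  meadow_cancel : forall x y z : meadow_ring, x <> 0 -> x * y = x * z -> y = z;
  sgn_div : forall x : meadow_ring, sgn (x * minv x) = x * minv x;
  sgn_cdiv : forall x : meadow_ring, sgn (1 - x * minv x) = 1 - x * minv x;
  sgnN1 : sgn (-1) = -1;
  sgnV : forall x, sgn (minv x) = sgn x;
  sgnM : forall x y : meadow_ring, sgn (x * y) = sgn x * sgn y;
  sgnD : forall x y : meadow_ring,
    (1 - (sgn x - sgn y) * minv (sgn x - sgn y)) * (sgn (x + y) - sgn x) = 0
}.

Definition isProb (M : signedMeadow) (p : M) : bool :=
  sgn (sgn p + 1) * sgn (sgn (1 - p) + 1) == 1.

Definition Prob (M : signedMeadow) := {p : M | isProb p}.

Section MeadowTheory.
Variable M : signedMeadow.
Implicit Types x y : M.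

Lemma mulfV x : x <> 0 -> x * minv x = 1.
Proof. by move=> x0; apply: (meadow_cancel x0); rewrite mulmV mulr1. Qed.

Lemma minv0 : minv 0 = 0 :> M.
Proof. by rewrite -(mulmV (minv 0)) minvK !mulr0. Qed.

Lemma sgn0 : sgn 0 = 0 :> M.
Proof. by have := @sgn_div M 0; rewrite mul0r. Qed.

Lemma sgn1 : sgn 1 = 1 :> M.
Proof. by have := @sgn_cdiv M 0; rewrite mul0r subr0. Qed.

Lemma sgnN x : sgn (- x) = - sgn x.
Proof. by rewrite -mulN1r sgnM sgnN1 mulN1r. Qed.

Lemma sgn_eqD x y : sgn x = sgn y -> sgn (x + y) = sgn x.
Proof.
move=> e; have := sgnD x y.
by rewrite e subrr mul0r subr0 mul1r => /eqP; rewrite subr_eq0 => /eqP.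
Qed.

Lemma mmul_eq0 x y : x * y = 0 -> x = 0 \/ y = 0.
Proof.
move=> e; have [->|/eqP x0] := eqVneq x 0; first by left.
by right; apply: (meadow_cancel x0); rewrite e mulr0.
Qed.

Lemma sgn_cases x : [\/ x = 0, sgn x = 1 | sgn x = -1].
Proof.
have [->|/eqP x0] := eqVneq x 0; first by constructor 1.
have e : (sgn x - 1) * (sgn x + 1) = 0.
  have : sgn x * sgn x = 1 by rewrite -{2}sgnV -sgnM mulfV // sgn1.
  by move=> e; transitivity (sgn x * sgn x - 1); [ring | rewrite e subrr].
case: (mmul_eq0 e) => /eqP.
  by rewrite subr_eq0 => /eqP; constructor 2.
by rewrite addr_eq0 => /eqP; constructor 3.
Qed.

Hypothesis nz : (1 : M) <> 0.

Lemma one_neqN1 : (1 : M) <> -1.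
Proof.
move=> e; apply: nz; have := @sgn_eqD 1 1 (erefl _).
by rewrite {2}e subrr sgn0 sgn1.
Qed.

Definition nn x := sgn x <> -1.

Lemma nnP x : nn x -> x = 0 \/ sgn x = 1.
Proof. by case: (sgn_cases x) => [->|->|//]; [left|right]. Qed.

Lemma nn0 : nn 0.
Proof. by rewrite /nn sgn0 => /eqP; rewrite eq_sym oppr_eq0 => /eqP. Qed.

Lemma sgn1_nn x : sgn x = 1 -> nn x.
Proof. by rewrite /nn => ->; apply: one_neqN1. Qed.

Lemma nnD x y : nn x -> nn y -> nn (x + y).
Proof.
move=> /nnP[-> hy|ex]; first by rewrite add0r.
move=> /nnP[->|ey]; first by rewrite addr0; apply: sgn1_nn.
by apply: sgn1_nn; rewrite sgn_eqD // ex ey.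
Qed.

Lemma nnM x y : nn x -> nn y -> nn (x * y).
Proof.
move=> /nnP[-> hy|ex]; first by rewrite mul0r; apply: nn0.
move=> /nnP[->|ey]; first by rewrite mulr0; apply: nn0.
by apply: sgn1_nn; rewrite sgnM ex ey mulr1.
Qed.

Lemma nnV x : nn x -> nn (minv x).
Proof. by rewrite /nn sgnV. Qed.

Lemma nn_anti x : nn x -> nn (- x) -> x = 0.
Proof. by move=> /nnP[//|ex]; rewrite /nn sgnN ex. Qed.

Lemma sgn_nn1 x : sgn (sgn x + 1) = if sgn x == -1 then 0 else 1.
Proof.
case: (sgn_cases x) => [->|->|->].
- by rewrite sgn0 add0r sgn1; case: eqP => // e; case: nn0; rewrite sgn0.
- by rewrite sgn_eqD ?sgn1 //; case: eqP => // e; case: one_neqN1.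
- by rewrite addNr sgn0 eqxx.
Qed.

Lemma isProbP x : isProb x <-> nn x /\ nn (1 - x).
Proof.
rewrite /isProb !sgn_nn1 /nn; split.
  by case: (sgn x =P -1) => ?; case: (sgn (1 - x) =P -1) => ?;
    rewrite ?(mul0r, mulr0) // => /eqP/esym.
by case=> /eqP/negbTE-> /eqP/negbTE->; rewrite mulr1.
Qed.

End MeadowTheory.

Lemma isProb_triv (M : signedMeadow) (x : M) : (1 : M) = 0 -> isProb x.
Proof. by move=> e; apply/eqP; rewrite -[LHS]mulr1 e mulr0. Qed.

Section ProbClosure.
Variable M : signedMeadow.
Implicit Types x y : M.

Lemma isProb0 : isProb (0 : M).
Proof.
have [/isProb_triv //|/eqP nz] := eqVneq (1 : M) 0.
apply/isProbP => //; split; first exact: nn0.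
by rewrite subr0; apply/sgn1_nn/sgn1.
Qed.

Lemma isProbC x : isProb x -> isProb (1 - x).
Proof.
have [/isProb_triv //|/eqP nz] := eqVneq (1 : M) 0.
by move=> /(isProbP nz)[? ?]; apply/(isProbP nz); rewrite subKr.
Qed.

Lemma isProb1 : isProb (1 : M).
Proof. by rewrite -[1]subr0 isProbC // isProb0. Qed.

Lemma isProbM x y : isProb x -> isProb y -> isProb (x * y).
Proof.
have [/isProb_triv //|/eqP nz] := eqVneq (1 : M) 0.
move=> /(isProbP nz)[x0 x1] /(isProbP nz)[y0 y1]; apply/(isProbP nz).
split; first exact: nnM.
have -> : 1 - x * y = (1 - x) + x * (1 - y) by ring.
by apply: nnD => //; apply: nnM.
Qed.

Lemma isProb_frac x y : (1 : M) <> 0 -> nn x -> nn (y - x) -> isProb (x * minv y).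
Proof.
move=> nz x0 xy; have [->|/eqP y0] := eqVneq y 0; first by rewrite minv0 mulr0 isProb0.
have ny : nn y by rewrite -(subrK x y); apply: nnD.
apply/(isProbP nz); split; first by apply: nnM => //; apply: nnV.
by rewrite -(mulfV y0) -mulrBl; apply: nnM => //; apply: nnV.
Qed.

Lemma isProb_assoc x y :
  isProb x -> isProb y -> isProb ((1 - x) * y * minv (1 - x * y)).
Proof.
have [/isProb_triv //|/eqP nz] := eqVneq (1 : M) 0.
move=> /(isProbP nz)[x0 x1] /(isProbP nz)[y0 y1].
apply: isProb_frac => //; first exact: nnM.
by have -> : 1 - x * y - (1 - x) * y = 1 - y by ring.
Qed.

End ProbClosure.

(* Total coercion into [Prob]: the default value is never reached, as shown by
   [isProbC], [isProbM], [isProb_assoc] and [renorm_ok]. *)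
Definition prob1 (M : signedMeadow) : Prob M := exist _ 1 (isProb1 M).
Definition toProb (M : signedMeadow) (p : M) : Prob M := insubd (prob1 M) p.

(* Terms over the signature of pACP extended with, for each [n], the [n]-ary
   operators in [O n].  The constants for [A] and [delta] are
   [act (Some a)] and [act None]; the set of variables is [nat].  *)
Inductive term (M : signedMeadow) (A : Type) (O : nat -> Type) : Type :=
| var of nat
| act of option A
| alt of term M A O & term M A O
| seqc of term M A O & term M A O
| pch of Prob M & term M A O & term M A O
| par of term M A O & term M A O
| lmerge of term M A O & term M A O
| cmerge of term M A O & term M A O
| encap of (A -> Prop) & term M A O
| op n of O n & ('I_n -> term M A O).

Arguments var {M A O}.
Arguments act {M A O}.
Arguments alt {M A O}.
Arguments seqc {M A O}.
Arguments pch {M A O}.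
Arguments par {M A O}.
Arguments lmerge {M A O}.
Arguments cmerge {M A O}.
Arguments encap {M A O}.
Arguments op {M A O n}.

Declare Scope proc_scope.
Delimit Scope proc_scope with proc.
Bind Scope proc_scope with term.
Notation "'delta'" := (act None) : proc_scope.
Notation "x + y" := (alt x y) : proc_scope.
Notation "x * y" := (seqc x y) : proc_scope.
Notation "x <+{ p } y" := (pch p x y)
  (at level 48, p at level 200, left associativity,
   format "x  <+{ p }  y") : proc_scope.
Notation "x ||| y" := (par x y) (at level 45, left associativity) : proc_scope.
Notation "x ||_ y" := (lmerge x y) (at level 45, left associativity) : proc_scope.
Notation "x |&| y" := (cmerge x y) (at level 45, left associativity) : proc_scope.

Section TermOps.
Variables (M : signedMeadow) (A : Type).

Fixpoint tsubst (O : nat -> Type) (sg : nat -> term M A O) (t : term M A O) :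
  term M A O :=
  match t with
  | var X => sg X
  | act a => act a
  | alt t u => alt (tsubst sg t) (tsubst sg u)
  | seqc t u => seqc (tsubst sg t) (tsubst sg u)
  | pch p t u => pch p (tsubst sg t) (tsubst sg u)
  | par t u => par (tsubst sg t) (tsubst sg u)
  | lmerge t u => lmerge (tsubst sg t) (tsubst sg u)
  | cmerge t u => cmerge (tsubst sg t) (tsubst sg u)
  | encap H t => encap H (tsubst sg t)
  | op _ o x => op o (fun i => tsubst sg (x i))
  end.

Definition subst1 (O : nat -> Type) (z : nat) (u : term M A O) : nat -> term M A O :=
  fun X => if X == z then u else var X.

Fixpoint tmap (O O' : nat -> Type) (f : forall n, O n -> O' n) (t : term M A O) :
  term M A O' :=
  match t with
  | var X => var X
  | act a => act a
  | alt t u => alt (tmap f t) (tmap f u)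
  | seqc t u => seqc (tmap f t) (tmap f u)
  | pch p t u => pch p (tmap f t) (tmap f u)
  | par t u => par (tmap f t) (tmap f u)
  | lmerge t u => lmerge (tmap f t) (tmap f u)
  | cmerge t u => cmerge (tmap f t) (tmap f u)
  | encap H t => encap H (tmap f t)
  | op n o x => op (f n o) (fun i => tmap f (x i))
  end.

Variable O : nat -> Type.
Implicit Types t u : term M A O.

Definition is_action t : bool := if t is act (Some _) then true else false.

(* [occurs X g t]: the variable [X] has an occurrence in [t]; the boolean [g]
   tells whether this occurrence is guarded, that is, lies in the right-hand
   operand [t'] of some subterm [a * t'] with [a] in [A]. *)
Inductive occurs (X : nat) : bool -> term M A O -> Prop :=
| occ_var : occurs X false (var X)
| occ_altl g t u : occurs X g t -> occurs X g (alt t u)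
| occ_altr g t u : occurs X g u -> occurs X g (alt t u)
| occ_seqcl g t u : occurs X g t -> occurs X g (seqc t u)
| occ_seqcr g t u : occurs X g u -> occurs X (is_action t || g) (seqc t u)
| occ_pchl g p t u : occurs X g t -> occurs X g (pch p t u)
| occ_pchr g p t u : occurs X g u -> occurs X g (pch p t u)
| occ_parl g t u : occurs X g t -> occurs X g (par t u)
| occ_parr g t u : occurs X g u -> occurs X g (par t u)
| occ_lmergel g t u : occurs X g t -> occurs X g (lmerge t u)
| occ_lmerger g t u : occurs X g u -> occurs X g (lmerge t u)
| occ_cmergel g t u : occurs X g t -> occurs X g (cmerge t u)
| occ_cmerger g t u : occurs X g u -> occurs X g (cmerge t u)
| occ_encap g H t : occurs X g t -> occurs X g (encap H t)
| occ_op g n (o : O n) x i : occurs X g (x i) -> occurs X g (op o x).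

Definition closed t := forall X g, ~ occurs X g t.
Definition guarded t := forall X g, occurs X g t -> g.

End TermOps.

(* The notation \bigoplus_(i = 1)^(n + 1) [w i] (t i). *)
Fixpoint bigpch (M : signedMeadow) (A : Type) (O : nat -> Type) (n : nat) :
  ('I_n.+1 -> M) -> ('I_n.+1 -> term M A O) -> term M A O :=
  match n return ('I_n.+1 -> M) -> ('I_n.+1 -> term M A O) -> term M A O with
  | 0 => fun _ t => t ord0
  | n'.+1 => fun w t =>
      pch (toProb (w ord0)) (t ord0)
        (bigpch (fun i => w (lift ord0 i) * minv (1 - w ord0))
                (fun i => t (lift ord0 i)))
  end.

(* The weights met when [bigpch] recurses stay in [Prob].  If [w ord0 = 1],
   the remaining weights all become 0, as [0 / 0 = 0] in a meadow. *)
Definition weights_ok (M : signedMeadow) n (w : 'I_n -> M) : Prop :=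
  (forall i, isProb (w i)) /\ (\sum_i w i = 1 \/ forall i, w i = 0).

Lemma renorm_ok (M : signedMeadow) n (w : 'I_n.+1 -> M) :
  weights_ok w -> weights_ok (fun i => w (lift ord0 i) * minv (1 - w ord0)).
Proof.
move=> [wP w1].
have [e|/eqP nz] := eqVneq (1 : M) 0.
  split=> [i|]; first exact: isProb_triv.
  by right=> i; rewrite -[LHS]mulr1 e mulr0.
case: w1 => [w1|w0]; last first.
  by split=> [i|]; [|right=> i]; rewrite w0 mul0r ?isProb0.
have e : 1 - w ord0 = \sum_i w (lift ord0 i).
  by rewrite -w1 big_ord_recl addrC addKr.
have wn i : nn (w i) by have /(isProbP nz)[] := wP i.
split=> [i|].
  apply: isProb_frac => //; rewrite e (bigD1 i) //=.
  rewrite [X in nn X]addrC addKr.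
  by elim/big_ind: _ => [|x y|j _]; [exact: nn0 | exact: nnD | exact: wn].
have [e0|/eqP ne0] := eqVneq (1 - w ord0) 0.
  by right=> i; rewrite e0 minv0 mulr0.
by left; rewrite -mulr_suml -e mulfV.
Qed.

Section Derivability.
Variables (M : signedMeadow) (A : Type) (O : nat -> Type).
Local Notation T := (term M A O).

(* A set of conditional equations: [Ax P l r] stands for [P => l = r], where
   the possibly infinite set of premises [P] is a binary relation on terms.
   All axiom sets below are closed under substitution: they list every
   substitution instance of the axioms. *)
Definition axioms := (T -> T -> Prop) -> T -> T -> Prop.

Inductive derivable (Ax : axioms) : T -> T -> Prop :=
| d_refl t : derivable Ax t t
| d_sym t u : derivable Ax t u -> derivable Ax u t
| d_trans t u v : derivable Ax t u -> derivable Ax u v -> derivable Ax t v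
| d_alt t t' u u' : derivable Ax t t' -> derivable Ax u u' ->
    derivable Ax (alt t u) (alt t' u')
| d_seqc t t' u u' : derivable Ax t t' -> derivable Ax u u' ->
    derivable Ax (seqc t u) (seqc t' u')
| d_pch p t t' u u' : derivable Ax t t' -> derivable Ax u u' ->
    derivable Ax (pch p t u) (pch p t' u')
| d_par t t' u u' : derivable Ax t t' -> derivable Ax u u' ->
    derivable Ax (par t u) (par t' u')
| d_lmerge t t' u u' : derivable Ax t t' -> derivable Ax u u' ->
    derivable Ax (lmerge t u) (lmerge t' u')
| d_cmerge t t' u u' : derivable Ax t t' -> derivable Ax u u' ->
    derivable Ax (cmerge t u) (cmerge t' u')
| d_encap H t t' : derivable Ax t t' -> derivable Ax (encap H t) (encap H t')
| d_op n (o : O n) x y : (forall i, derivable Ax (x i) (y i)) ->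
    derivable Ax (op o x) (op o y)
| d_ax (P : T -> T -> Prop) l r : Ax P l r ->
    (forall u v, P u v -> derivable Ax u v) -> derivable Ax l r.

Definition noprem : T -> T -> Prop := fun _ _ => False.

(* The premises [x i = x i + x i], for all [i]. *)
Definition idem (I : Type) (x : I -> T) : T -> T -> Prop :=
  fun u v => exists i, u = x i /\ v = alt (x i) (x i).

End Derivability.

Arguments noprem {M A O}.

(* [option A] is the set of actions with [None] as [delta]. *)
Record commFun (A : Type) := CommFun {
  gamma :> option A -> option A -> option A;
  gammaC : forall a b, gamma a b = gamma b a;
  gammaA : forall a b c, gamma a (gamma b c) = gamma (gamma a b) c;
  gamma_delta : forall a, gamma None a = None
}.

Section PACP.
Variables (M : signedMeadow) (A : Type) (ga : commFun A) (O : nat -> Type).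
Implicit Types (x y z : term M A O) (a b : option A) (H : A -> Prop)
  (p q : Prob M).

Definition in_enc H a : Prop := if a is Some c then H c else False.

Local Open Scope proc_scope.

Inductive pACP_ax : axioms M A O :=
| A1 x y : pACP_ax noprem (x + y) (y + x)
| A2 x y z : pACP_ax noprem ((x + y) + z) (x + (y + z))
| A3' a : pACP_ax noprem (act a + act a) (act a)
| A4 x y z : pACP_ax noprem ((x + y) * z) (x * z + y * z)
| A5 x y z : pACP_ax noprem ((x * y) * z) (x * (y * z))
| A6 x : pACP_ax noprem (x + delta) x
| A7 x : pACP_ax noprem (delta * x) delta
| D1 H a : ~ in_enc H a -> pACP_ax noprem (encap H (act a)) (act a)
| D2 H a : in_enc H a -> pACP_ax noprem (encap H (act a)) delta
| D3 H x y : pACP_ax noprem (encap H (x + y)) (encap H x + encap H y)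
| D4 H x y : pACP_ax noprem (encap H (x * y)) (encap H x * encap H y)
| pA1 p x y : pACP_ax noprem (x <+{p} y) (y <+{toProb (1 - val p)%R} x)
| pA2 p q x y z : pACP_ax noprem ((x <+{p} y) <+{q} z)
    (x <+{toProb (val p * val q)%R}
      (y <+{toProb ((1 - val p) * val q * minv (1 - val p * val q))%R} z))
| pA3 p x : pACP_ax noprem (x <+{p} x) x
| pA4 p x y z : pACP_ax noprem ((x <+{p} y) * z) ((x * z) <+{p} (y * z))
| pA5 p x y z : pACP_ax noprem ((x <+{p} y) + z) ((x + z) <+{p} (y + z))
| pA6 x y : pACP_ax noprem (x <+{prob1 M} y) x
| CM1' x y : pACP_ax (idem (fun b : bool => if b then x else y))
    (x ||| y) ((x ||_ y + y ||_ x) + x |&| y)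
| CM2 a x : pACP_ax noprem (act a ||_ x) (act a * x)
| CM3 a x y : pACP_ax noprem ((act a * x) ||_ y) (act a * (x ||| y))
| CM4 x y z : pACP_ax noprem ((x + y) ||_ z) (x ||_ z + y ||_ z)
| CM5 a b x : pACP_ax noprem ((act a * x) |&| act b) (act (ga a b) * x)
| CM6 a b x : pACP_ax noprem (act a |&| (act b * x)) (act (ga a b) * x)
| CM7 a b x y :
    pACP_ax noprem ((act a * x) |&| (act b * y)) (act (ga a b) * (x ||| y))
| CM8 x y z : pACP_ax noprem ((x + y) |&| z) (x |&| z + y |&| z)
| CM9 x y z : pACP_ax noprem (x |&| (y + z)) (x |&| y + x |&| z)
| CM10 x : pACP_ax noprem (delta |&| x) delta
| CM11 x : pACP_ax noprem (x |&| delta) delta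
| CM12 a b : pACP_ax noprem (act a |&| act b) (act (ga a b))
| pCM1 p x y z : pACP_ax noprem ((x <+{p} y) ||| z) ((x ||| z) <+{p} (y ||| z))
| pCM2 p x y z : pACP_ax noprem (x ||| (y <+{p} z)) ((x ||| y) <+{p} (x ||| z))
| pCM3 p x y z : pACP_ax noprem ((x <+{p} y) ||_ z) ((x ||_ z) <+{p} (y ||_ z))
| pCM4 p x y z : pACP_ax noprem (x ||_ (y <+{p} z)) ((x ||_ y) <+{p} (x ||_ z))
| pCM5 p x y z : pACP_ax noprem ((x <+{p} y) |&| z) ((x |&| z) <+{p} (y |&| z))
| pCM6 p x y z : pACP_ax noprem (x |&| (y <+{p} z)) ((x |&| y) <+{p} (x |&| z))
| pD H p x y :
    pACP_ax noprem (encap H (x <+{p} y)) (encap H x <+{p} encap H y).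

End PACP.

Definition noop (n : nat) : Type := void.
Definition noopE (O : nat -> Type) n (o : noop n) : O n := of_void _ o.

(* In a pair [(i, n)], [n] is the number of processes left after the [i]-th
   process (counted from 1) has been scheduled.

   One-step histories [(i, n)] are admitted for [i <= n.+1], not only for
   [i <= n]: if, with the empty history, the last of [n.+1] processes is
   scheduled and terminates, then the new history required by [SI4] is
   [(n.+1, n)].  After a nonempty history, the last clause admits that step. *)
Inductive hist : nat -> seq (nat * nat) -> Prop :=
| hist_nil n : (0 < n)%N -> hist n [::]
| hist_one n i : (0 < n)%N -> (0 < i <= n.+1)%N -> hist n [:: (i, n)]
| hist_snoc n m i j h : hist n (rcons h (i, n)) ->
    (0 < j <= n)%N -> (0 < m)%N -> (n.-1 <= m <= n.+1)%N ->
    hist m (rcons (rcons h (i, n)) (j, m)).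

Record history (n : nat) := History { hseq :> seq (nat * nat); _ : hist n hseq }.

Lemma hist_last n h i m : hist n (rcons h (i, m)) -> m = n.
Proof.
suff H k : hist n k -> (last (0, n)%N k).2 = n by move=> /H; rewrite last_rcons.
by case=> *; rewrite ?last_rcons.
Qed.

Lemma hist_rcons n m (h : history n) (i : 'I_n) : (0 < m)%N ->
  (n.-1 <= m <= n.+1)%N -> hist m (rcons h (i.+1, m)).
Proof.
case: h => h /= hh m0 nm; have := ltn_ord i.
case/lastP: h hh => [|h [j k]] hh lti.
  by apply: hist_one => //=; lia.
by have ek := hist_last hh; subst k; apply: hist_snoc.
Qed.

Section Extend.
Variable n : nat.
Implicit Types (h : history n.+1) (i : 'I_n.+1).

Lemma hist_keep h i : hist n.+1 (rcons h (i.+1, n.+1)%N).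
Proof. by apply: hist_rcons; lia. Qed.

Lemma hist_incr h i : hist n.+2 (rcons h (i.+1, n.+2)%N).
Proof. by apply: hist_rcons; lia. Qed.

Lemma hist_decr (h : history n.+2) (i : 'I_n.+2) : hist n.+1 (rcons h (i.+1, n.+1)%N).
Proof. by apply: hist_rcons; lia. Qed.

(* The history extended with the scheduling of [i], the number of processes
   being left unchanged, incremented or decremented by the step. *)
Definition hkeep h i : history n.+1 := History (hist_keep h i).
Definition hincr h i : history n.+2 := History (hist_incr h i).
Definition hdecr (h : history n.+2) (i : 'I_n.+2) : history n.+1 :=
  History (hist_decr h i).

End Extend.

(* Arities are positive: [SIop h s] and [PSIop i h s] are the strategic
   interleaving operators ||^(n+1)_(h, s) and ||^(n+1)_(i, h, s). *)
Inductive siop (S : Type) : nat -> Type :=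
| SIop n (h : history n.+1) (s : S) : siop S n.+1
| PSIop n (i : 'I_n.+1) (h : history n.+1) (s : S) : siop S n.+1.

(* The last argument of [updat] is [true] for 1 and [false] for 0. *)
Record strategy (M : signedMeadow) (A : Type) (ga : commFun A) := Strategy {
  cstate : Type;
  sched : forall n, history n.+1 -> cstate -> option ('I_n.+1 -> Prob M);
  sched_sum : forall n (h : history n.+1) s f,
    sched h s = Some f -> \sum_i val (f i) = 1;
  updat : forall n, history n.+1 -> cstate -> 'I_n.+1 -> A -> bool -> cstate;
  ctrl : A -> Prop;
  updat_noctrl : forall n (h : history n.+1) s i a,
    ~ ctrl a -> updat h s i a false = s;
  ctrl_bar : forall c, ctrl c -> exists2 c', ~ ctrl c' &
    forall a b : A, [/\ ga (Some a) (Some b) <> Some c,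
                        ga (Some a) (Some b) <> Some c',
                        ga (Some a) (Some c) = None &
                        ga (Some a) (Some c') = None];
  data : Type;
  pcr : data -> A;
  rcr : data -> A;
  pcr_comm : forall d a, ga (Some (pcr d)) (Some a) = None;
  pcr_nocomm : forall d a b, ga (Some a) (Some b) <> Some (pcr d);
  crea : data -> term M A (siop cstate);
  crea_closed : forall d, closed (crea d)
}.

Definition upd (T : Type) n (x : 'I_n -> T) (i : 'I_n) (u : T) : 'I_n -> T :=
  fun j => if j == i then u else x j.
Definition remove (T : Type) n (x : 'I_n.+1 -> T) (i : 'I_n.+1) : 'I_n -> T :=
  fun j => x (lift i j).
Definition append (T : Type) n (x : 'I_n -> T) (u : T) : 'I_n.+1 -> T :=
  fun j => if unlift ord_max j is Some k then x k else u.

Section PSI.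
Variables (M : signedMeadow) (A : Type) (ga : commFun A) (st : strategy M ga).
Variables (O : nat -> Type) (emb : forall n, siop (cstate st) n -> O n).
Local Notation T := (term M A O).

Definition si n (h : history n.+1) s (x : 'I_n.+1 -> T) : T :=
  op (emb (SIop h s)) x.
Definition psi n (i : 'I_n.+1) (h : history n.+1) s (x : 'I_n.+1 -> T) : T :=
  op (emb (PSIop i h s)) x.

Local Notation actA a := (act (Some a)).
Local Notation creat d := (tmap emb (crea d)).

(* The actions to which [SI3], [SI4] and [SI5] apply: all those to which [SI6]
   and [SI7] do not.  In particular the actions [rcr d] are included.  With the
   side condition that [a] is neither of the form [pcr d] nor of the form
   [rcr d], no axiom would apply to [psi i h s x] if [x i] is
   [actA (rcr d)]: both [actA (rcr d)] and [delta] would be possible values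
   of [psi ord0 h s (fun=> actA (rcr d))], so that this closed term would not
   be derivably equal to any term without strategic interleaving operators. *)
Definition plain (a : A) : Prop := forall d : data st, a <> pcr d.

Local Open Scope proc_scope.

Inductive SI_ax : axioms M A O :=
| SI0' n (h : history n.+1) s x : sched h s = None ->
    SI_ax (idem x) (si h s x) delta
| SI1' n (h : history n.+1) s x f : sched h s = Some f ->
    SI_ax (idem x) (si h s x)
      (bigpch (fun i => val (f i)) (fun i => psi i h s x))
| SI2 n i (h : history n.+1) s x :
    SI_ax noprem (psi i h s (upd x i delta)) delta
| SI3 i (h : history 1) s a : plain a ->
    SI_ax noprem (psi i h s (fun=> actA a)) (actA a)
| SI4 n i (h : history n.+2) s x a : plain a ->
    SI_ax noprem (psi i h s (upd x i (actA a)))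
      (actA a * si (hdecr h i) (updat h s i a true) (remove x i))
| SI5 n i (h : history n.+1) s x a x' : plain a ->
    SI_ax noprem (psi i h s (upd x i (actA a * x')))
      (actA a * si (hkeep h i) (updat h s i a false) (upd x i x'))
| SI6 n i (h : history n.+1) s x (d : data st) :
    SI_ax noprem (psi i h s (upd x i (actA (pcr d))))
      (actA (rcr d) * si (hkeep h i) (updat h s i (pcr d) true)
                         (append (remove x i) (creat d)))
| SI7 n i (h : history n.+1) s x (d : data st) x' :
    SI_ax noprem (psi i h s (upd x i (actA (pcr d) * x')))
      (actA (rcr d) * si (hincr h i) (updat h s i (pcr d) false)
                         (append (upd x i x') (creat d)))
| SI8 n i (h : history n.+1) s x x' x'' :
    SI_ax noprem (psi i h s (upd x i (x' + x'')))
      (psi i h s (upd x i x') + psi i h s (upd x i x''))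
| pSI1 n (i : 'I_n.+1) (h : history n.+1) s x p x' x'' :
    SI_ax noprem (si h s (upd x i (x' <+{p} x'')))
      (si h s (upd x i x') <+{p} si h s (upd x i x''))
| pSI2 n i (h : history n.+1) s x p x' x'' :
    SI_ax noprem (psi i h s (upd x i (x' <+{p} x'')))
      (psi i h s (upd x i x') <+{p} psi i h s (upd x i x'')).

Definition pACPpSI_ax : axioms M A O :=
  fun P l r => pACP_ax ga P l r \/ SI_ax P l r.

End PSI.

Section Recursion.
Variables (M : signedMeadow) (A : Type) (O : nat -> Type).
Local Notation T := (term M A O).
Implicit Types (E : nat -> option (term M A O)).

(* A set of equations [X = t] with distinct left-hand sides in a countable set
   of variables is a partial function from variables to terms. *)
Definition vars E (X : nat) : bool := isSome (E X).

Definition rec_spec E :=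
  forall X t, E X = Some t -> forall Y g, occurs Y g t -> vars E Y.

(* Rewriting with the axioms [Ax] in either direction (the premises of the
   conditional axioms being derivable from [Ax]) and with the equations of [E],
   except the one for [X], from left to right.  The variable [z] marks the
   place in the context [c] where the equation [Y = t] is applied. *)
Inductive rewrites (Ax : axioms M A O) E (X : nat) : T -> T -> Prop :=
| rw_ax t u : derivable Ax t u -> rewrites Ax E X t u
| rw_eqn c z Y t : Y <> X -> E Y = Some t ->
    rewrites Ax E X (tsubst (subst1 z (var Y)) c) (tsubst (subst1 z t) c)
| rw_trans t u v : rewrites Ax E X t u -> rewrites Ax E X u v ->
    rewrites Ax E X t v.

Definition guarded_spec (Ax : axioms M A O) E :=
  rec_spec E /\
  forall X t, E X = Some t -> exists2 u, rewrites Ax E X t u & guarded u.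

End Recursion.

Section Specs.
Variables (M : signedMeadow) (A : Type) (ga : commFun A) (st : strategy M ga).

Definition pACP_spec := nat -> option (term M A noop).
Definition pSI_spec := nat -> option (term M A (siop (cstate st))).

Definition pACP_guarded (E : pACP_spec) := guarded_spec (pACP_ax ga (O := noop)) E.
Definition pSI_guarded (E : pSI_spec) :=
  guarded_spec (pACPpSI_ax (st := st) (fun n o => o)) E.

Record recconst := RecConst {
  rc_spec : pSI_spec;
  rc_guarded : pSI_guarded rc_spec;
  rc_var : nat;
  rc_vars : vars rc_spec rc_var
}.

Inductive sirop : nat -> Type :=
| SIRop n (o : siop (cstate st) n) : sirop n
| Rec (c : recconst) : sirop 0.

Local Notation T := (term M A sirop).

Definition rec_term (E : pSI_spec) (gE : pSI_guarded E) X (vX : vars E X) : T :=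
  op (Rec (RecConst gE vX)) (fun i => var i).

(* <t|E> *)
Definition rec_subst (E : pSI_spec) (gE : pSI_guarded E)
    (t : term M A (siop (cstate st))) : T :=
  tsubst (fun Y => (if vars E Y as b return vars E Y = b -> T
                    then fun vY => rec_term gE vY
                    else fun _ => var Y) (erefl _))
         (tmap SIRop t).

Inductive rec_ax : axioms M A sirop :=
| RDP E (gE : pSI_guarded E) X (vX : vars E X) t : E X = Some t ->
    rec_ax noprem (rec_term gE vX) (rec_subst gE t)
| RSP E (gE : pSI_guarded E) X (vX : vars E X) (sg : nat -> T) :
    rec_ax (fun u v => exists Y t,
              [/\ E Y = Some t, u = sg Y & v = tsubst sg (tmap SIRop t)])
           (sg X) (rec_term gE vX).

Definition pACPpSIr_ax : axioms M A sirop :=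
  fun P l r => pACPpSI_ax SIRop P l r \/ rec_ax P l r.

Definition embed (E : pACP_spec) : pSI_spec :=
  fun X => omap (tmap (@noopE (siop (cstate st)))) (E X).

Lemma vars_embed E X : vars E X -> vars (embed E) X.
Proof. by rewrite /vars /embed; case: (E X). Qed.

Let em := tmap (M := M) (A := A) (@noopE (siop (cstate st))).

Lemma em_subst sg t : em (tsubst sg t) = tsubst (fun X => em (sg X)) (em t).
Proof.
rewrite /em; elim: t => [?|?|?|?|?|?|?|?|?|n o] /=; try by move=> *; congruence.
by case: (o : void).
Qed.

Lemma em_subst1 z u c :
  tsubst (fun X => em (subst1 z u X)) (em c) = tsubst (subst1 z (em u)) (em c).
Proof.
rewrite /em; elim: c => [X|?|?|?|?|?|?|?|?|n o] /=; try by move=> *; congruence.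
  by rewrite /subst1; case: eqP.
by case: (o : void).
Qed.

Lemma em_is_action t : is_action (em t) = is_action t.
Proof. by case: t. Qed.

Lemma em_occurs X g t : occurs X g (em t) -> occurs X g t.
Proof.
rewrite /em; elim: t g => /= [Y|a|t It u Iu|t It u Iu|p t It u Iu
  |t It u Iu|t It u Iu|t It u Iu|H t It|n []] g h; inversion h; subst;
  try by constructor; auto.
by rewrite em_is_action; constructor; auto.
Qed.

Lemma em_ax (P : term M A noop -> term M A noop -> Prop) l r : pACP_ax ga P l r ->
  pACP_ax ga noprem (em l) (em r) \/
  exists x y, P = idem (fun b : bool => if b then x else y) /\
  pACP_ax ga (idem (fun b : bool => if b then em x else em y)) (em l) (em r).
Proof.
by case=> *; try (by left; constructor); right; eexists; eexists; split;
  [reflexivity | constructor].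
Qed.

Lemma em_derivable t u : derivable (pACP_ax ga (O := noop)) t u ->
  derivable (pACPpSI_ax (st := st) (fun n o => o)) (em t) (em u).
Proof.
elim=> /= {t u}.
- by move=> t; apply: d_refl.
- by move=> t u _; apply: d_sym.
- by move=> t u v _ h1 _; apply: d_trans h1.
- by move=> t t' u u' _ h1 _; apply: d_alt.
- by move=> t t' u u' _ h1 _; apply: d_seqc.
- by move=> p t t' u u' _ h1 _; apply: d_pch.
- by move=> t t' u u' _ h1 _; apply: d_par.
- by move=> t t' u u' _ h1 _; apply: d_lmerge.
- by move=> t t' u u' _ h1 _; apply: d_cmerge.
- by move=> H t t' _; apply: d_encap.
- by move=> n o; case: (o : void).
move=> P l r /em_ax[h|[x [y [-> h]]]] _ IH.
- by apply: d_ax; [left; exact: h | ].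
- apply: d_ax; first by left; exact: h.
  by move=> _ _ [b [-> ->]]; have := IH _ _ (ex_intro _ b (conj erefl erefl));
    case: b.
Qed.

Lemma em_rewrites E X t u : rewrites (pACP_ax ga (O := noop)) E X t u ->
  rewrites (pACPpSI_ax (st := st) (fun n o => o)) (embed E) X (em t) (em u).
Proof.
elim=> {t u} [t u /em_derivable|c z Y t YX EY|t u v _ h1 _ h2].
- exact: rw_ax.
- by rewrite !em_subst !em_subst1; apply: rw_eqn; rewrite /embed ?EY.
- exact: rw_trans h1 h2.
Qed.

Lemma embed_guarded E : pACP_guarded E -> pSI_guarded (embed E).
Proof.
case=> rE gE; split=> X t'; rewrite /embed; case EX: (E X) => [t|//] [<-].
  by move=> Y g /em_occurs oY; apply/vars_embed/(rE _ _ EX _ _ oY).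
have [u ru gu] := gE _ _ EX; exists (em u); first exact: em_rewrites.
by move=> Y g /em_occurs; apply: gu.
Qed.

End Specs.

Arguments rec_term {M A ga st E} gE {X} vX.

(* Main.v *)
Require Import Defs.
From mathcomp Require Import all_boot all_algebra.
From Stdlib Require Import Classical FunctionalExtensionality IndefiniteDescription.
From Stdlib Require List.

Set Implicit Arguments.
Unset Strict Implicit.
Unset Printing Implicit Defensive.

(** Extend pACPpSI with the equations [Y = t] of [E], and with [Y = delta] for
    the variables [Y] that [E] does not define.  In this theory every term equals
    a head normal form, that is, a probabilistic choice between sums of actions
    and prefixes [a * t]: head normal forms are closed under all operators, and
    guardedness of [E] provides one for each variable.  As a head normal form has
    finitely many continuations [t], the terms reachable from [X] are indexed by
    finite paths, hence by natural numbers.  Their head normal forms, with the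
    continuations replaced by variables, make up a guarded recursive
    specification over pACP, of which these terms are a solution.  Substituting
    [<Y|E>] for each variable [Y] of [E], and [delta] for the others, turns it into
    a solution in pACPpSIr, to which RSP applies. *)

(* [sg (X + n)] is reached from [x] along the path, a sequence of naturals, coded
   by [n]. *)
Lemma enumerate_reachable (T : Type) (next : T -> nat -> T) (X : nat) (x : T) :
  exists2 sg : nat -> T, sg X = x &
    forall Y n, exists Z, sg Z = next (sg Y) n.
Proof.
pose sg Y := foldl next x (CodeSeq.decode (Y - X)).
exists sg => [|Y n]; first by rewrite /sg subnn.
exists (X + CodeSeq.code (rcons (CodeSeq.decode (Y - X)) n))%N.
by rewrite /sg addKn CodeSeq.codeK foldl_rcons.
Qed.

Section Interpretation.
Variables (M : signedMeadow) (A : Type) (O O' : nat -> Type).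
Variable f : forall n, O n -> O' n.
Implicit Types (sg : nat -> term M A O') (t : term M A O).

Definition interp sg t : term M A O' := tsubst sg (tmap f t).

Lemma interp_tsubst sg (th : nat -> term M A O) t :
  interp sg (tsubst th t) = interp (fun Y => interp sg (th Y)) t.
Proof.
rewrite /interp; elim: t => //=; try by move=> *; congruence.
by move=> n o x IHx; congr op; apply: functional_extensionality.
Qed.

Lemma eq_in_interp sg sg' t :
  (forall Y b, occurs Y b t -> sg Y = sg' Y) -> interp sg t = interp sg' t.
Proof.
rewrite /interp; elim: t => [Y|a|t IHt u IHu|t IHt u IHu|p t IHt u IHu
  |t IHt u IHu|t IHt u IHu|t IHt u IHu|H t IHt|n o x IHx] //= eq_sg.
- by apply: (eq_sg Y false); constructor.
1-6: by rewrite IHt ?IHu // => Y b ?; apply: (eq_sg Y); econstructor; eassumption.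
- by rewrite IHt // => Y b ?; apply: (eq_sg Y b); constructor.
- congr op; apply: functional_extensionality => i; apply: IHx => Y b ?.
  by apply: (eq_sg Y b); econstructor; eassumption.
Qed.

End Interpretation.

Lemma tsubst_var (M : signedMeadow) (A : Type) (O : nat -> Type) (t : term M A O) :
  tsubst var t = t.
Proof.
elim: t => //=; try by move=> *; congruence.
by move=> n o x IHx; congr op; apply: functional_extensionality.
Qed.

Lemma interp_tmap (M : signedMeadow) (A : Type) (O0 O O' : nat -> Type)
    (g : forall n, O0 n -> O n) (f : forall n, O n -> O' n) sg (t : term M A O0) :
  interp f sg (tmap g t) = interp (fun n o => f n (g n o)) sg t.
Proof.
rewrite /interp; elim: t => //=; try by move=> *; congruence.
by move=> n o x IHx; congr op; apply: functional_extensionality.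
Qed.

Lemma interp_closed (M : signedMeadow) (A : Type) (O O' : nat -> Type)
    (f : forall n, O n -> O' n) sg (t : term M A O) :
  Defs.closed t -> interp f sg t = tmap f t.
Proof.
move=> ct; rewrite (eq_in_interp f (sg' := var)); first exact: tsubst_var.
by move=> Y b /ct.
Qed.

Section Derivability.
Variables (M : signedMeadow) (A : Type) (O : nat -> Type).
Implicit Types (Ax : axioms M A O) (t u : term M A O).

Definition subtheory Ax Ax' := forall P l r, Ax P l r -> Ax' P l r.

Lemma derivable_ax Ax l r : Ax noprem l r -> derivable Ax l r.
Proof. by move=> axlr; apply: d_ax axlr _. Qed.

Lemma derivable_subtheory Ax Ax' t u :
  subtheory Ax Ax' -> derivable Ax t u -> derivable Ax' t u.
Proof.
move=> sub; elim=> {t u}; try by move=> *; constructor.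
- by move=> t u v _ tu _; apply: d_trans tu.
- by move=> P l r /sub axlr _; apply: d_ax axlr.
Qed.

Lemma derivable_tsubst Ax (sg sg' : nat -> term M A O) t :
  (forall Y, derivable Ax (sg Y) (sg' Y)) ->
  derivable Ax (tsubst sg t) (tsubst sg' t).
Proof. by move=> sg_sg'; elim: t => //= *; constructor. Qed.

Lemma rewrites_derivable Ax Ax' (E : nat -> option (term M A O)) X t u :
  subtheory Ax Ax' ->
  (forall Y t', E Y = Some t' -> derivable Ax' (var Y) t') ->
  rewrites Ax E X t u -> derivable Ax' t u.
Proof.
move=> sub eqE; elim=> {t u} [t u|c z Y t _ EY|t u v _ tu _].
- exact: derivable_subtheory.
- apply: derivable_tsubst => Z; rewrite /subst1; case: ifP => _.
    exact: eqE.
  exact: d_refl.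
- exact: d_trans tu.
Qed.

End Derivability.

Section Soundness.
Variables (M : signedMeadow) (A : Type) (O O' : nat -> Type).
Variables (f : forall n, O n -> O' n) (sg : nat -> term M A O').
Variable Ax' : axioms M A O'.
Local Notation "[| t |]" := (interp f sg t).

Definition interprets (Ax : axioms M A O) := forall P l r, Ax P l r ->
  (forall u v, P u v -> derivable Ax' [|u|] [|v|]) -> derivable Ax' [|l|] [|r|].

Lemma derivable_interp Ax t u :
  interprets Ax -> derivable Ax t u -> derivable Ax' [|t|] [|u|].
Proof.
move=> intAx; elim=> {t u}; try by move=> *; constructor.
- by move=> t u v _ tu _; apply: d_trans tu.
- by move=> P l r /intAx intlr _; apply: intlr.
Qed.

Variable ga : commFun A.

Lemma interprets_pACP : subtheory (pACP_ax ga (O := O')) Ax' ->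
  interprets (pACP_ax ga (O := O)).
Proof.
move=> sub P l r; case=> {P l r}; try by move=> *; apply/derivable_ax/sub; constructor.
move=> x y prem; apply: d_ax (sub _ _ _ (CM1' ga [|x|] [|y|])) _ => _ _ [b [-> ->]].
by have := prem _ _ (ex_intro _ b (conj erefl erefl)); case: b.
Qed.

Lemma interp_upd n (x : 'I_n -> term M A O) i u :
  (fun j => [|upd x i u j|]) = upd (fun j => [|x j|]) i [|u|].
Proof. by apply: functional_extensionality => j; rewrite /upd; case: eqP. Qed.

Lemma interp_append n (x : 'I_n -> term M A O) u :
  (fun j => [|append x u j|]) = append (fun j => [|x j|]) [|u|].
Proof. by apply: functional_extensionality => j; rewrite /append; case: unlift. Qed.

Lemma interp_bigpch n (w : 'I_n.+1 -> M) (t : 'I_n.+1 -> term M A O) :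
  [|bigpch w t|] = bigpch w (fun i => [|t i|]).
Proof.
by elim: n w t => [//|n IHn] w t; apply: (congr1 (pch _ _)); apply: IHn.
Qed.

Variables (st : strategy M ga) (emb : forall n, siop (cstate st) n -> O n).
Let emb' n (o : siop (cstate st) n) : O' n := f (emb o).

Lemma interp_si n (h : history n.+1) s x :
  [|si emb h s x|] = si emb' h s (fun j => [|x j|]).
Proof. by []. Qed.

Lemma interp_psi n i (h : history n.+1) s x :
  [|psi emb i h s x|] = psi emb' i h s (fun j => [|x j|]).
Proof. by []. Qed.

Lemma interp_crea (d : data st) : [|tmap emb (crea d)|] = tmap emb' (crea d).
Proof. by rewrite interp_tmap interp_closed //; apply: crea_closed. Qed.

Lemma interprets_SI : subtheory (SI_ax emb') Ax' -> interprets (SI_ax emb).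
Proof.
move=> sub P l r ax prem.
have idem_prem n (x : 'I_n -> term M A O) : P = idem x ->
    forall u v, idem (fun i => [|x i|]) u v -> derivable Ax' u v.
  move=> eP _ _ [i [-> ->]]; apply: (prem (x i) (alt (x i) (x i))).
  by rewrite eP; exists i.
have altE t u : [|alt t u|] = alt [|t|] [|u|] by [].
have pchE p t u : [|pch p t u|] = pch p [|t|] [|u|] by [].
have seqcE t u : [|seqc t u|] = seqc [|t|] [|u|] by [].
case: ax idem_prem {prem} => {P l r}.
- move=> n h s x undef /(_ _ _ erefl).
  exact: d_ax (sub _ _ _ (SI0' emb' _ undef)).
- move=> n h s x g def /(_ _ _ erefl); rewrite interp_bigpch.
  exact: d_ax (sub _ _ _ (SI1' emb' _ def)).
all: move=> *; apply/derivable_ax/sub.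
all: rewrite ?(altE, pchE, seqcE) ?(interp_psi, interp_si).
all: rewrite ?(interp_upd, interp_append, interp_crea) ?(altE, pchE, seqcE).
- exact: SI2.
- exact: SI3.
- exact: (SI4 _ _ _ _ (fun j => [|_ j|])).
- exact: SI5.
- exact: (SI6 _ _ _ _ (fun j => [|_ j|])).
- exact: SI7.
- exact: SI8.
- exact: pSI1.
- exact: pSI2.
Qed.

End Soundness.

Local Open Scope proc_scope.
Local Notation actA a := (act (Some a)).

Lemma upd_id (T : Type) n (x : 'I_n -> T) i : upd x i (x i) = x.
Proof. by apply: functional_extensionality => j; rewrite /upd; case: eqP => [->|]. Qed.

Section HeadNormalForms.
Variables (M : signedMeadow) (A : Type) (O : nat -> Type).
Local Notation T := (term M A O).
Implicit Types (a : option A) (t u v : T).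

(* Only actions and prefixes are summed, so that [basic] terms are idempotent,
   as the conditional axioms [CM1'], [SI0'] and [SI1'] require. *)
Inductive basic : T -> Prop :=
| BasicAct a : basic (act a)
| BasicPrefix (a : A) t : basic (actA a * t)
| BasicAlt t u : basic t -> basic u -> basic (t + u).

Inductive hnf : T -> Prop :=
| HnfBasic t : basic t -> hnf t
| HnfPch p t u : hnf t -> hnf u -> hnf (t <+{p} u).

Variable Ax : axioms M A O.
Local Notation "t === u" := (derivable Ax t u) (at level 70).

Definition derivably (P : T -> Prop) t := exists2 u, P u & t === u.

Lemma derivably_refl (P : T -> Prop) t : P t -> derivably P t.
Proof. by exists t => //; apply: d_refl. Qed.

Lemma derivably_trans P t u : t === u -> derivably P u -> derivably P t.
Proof. by move=> tu [v Pv uv]; exists v => //; apply: d_trans uv. Qed.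

Lemma hnf_basic t : derivably basic t -> derivably hnf t.
Proof. by case=> u bu tu; exists u => //; apply: HnfBasic. Qed.

Lemma basic_alt t u :
  derivably basic t -> derivably basic u -> derivably basic (t + u).
Proof.
by move=> [t' bt tt'] [u' bu uu']; exists (t' + u'); [constructor|apply: d_alt].
Qed.

Lemma hnf_pch p t u :
  derivably hnf t -> derivably hnf u -> derivably hnf (t <+{p} u).
Proof.
by move=> [t' ht tt'] [u' hu uu']; exists (t' <+{p} u'); [constructor|apply: d_pch].
Qed.

Lemma hnf_bigpch n (w : 'I_n.+1 -> M) (t : 'I_n.+1 -> T) :
  (forall i, derivably hnf (t i)) -> derivably hnf (bigpch w t).
Proof.
elim: n w t => [|n IHn] w t ht /=; first exact: ht.
by apply: hnf_pch => //; apply: IHn => i; apply: ht.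
Qed.

Lemma basic_alt_morphism (F : T -> T) :
    (forall t u, F (t + u) === F t + F u) ->
    (forall a, derivably basic (F (act a))) ->
    (forall (a : A) t, derivably basic (F (actA a * t))) ->
  forall t, basic t -> derivably basic (F t).
Proof.
move=> F_alt F_act F_pre t; elim=> {t} // t u _ Ft _ Fu.
by apply: derivably_trans (F_alt _ _) _; apply: basic_alt.
Qed.

Definition congruent (F : T -> T) := forall t u, t === u -> F t === F u.

Definition pch_morphism (F : T -> T) :=
  forall p t u, F (t <+{p} u) === F t <+{p} F u.

Lemma hnf_pch_morphism (F : T -> T) : congruent F -> pch_morphism F ->
    (forall t, basic t -> derivably hnf (F t)) ->
  forall t, derivably hnf t -> derivably hnf (F t).
Proof.
move=> congF F_pch F_basic t [t' ht /congF tt']; apply: derivably_trans tt' _.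
elim: ht => {t t'} [t|p t u _ Ft _ Fu]; first exact: F_basic.
by apply: derivably_trans (F_pch _ _ _) _; apply: hnf_pch.
Qed.

Lemma hnf_pch_bimorphism (F : T -> T -> T) :
    (forall u, congruent (F^~ u)) -> (forall t, congruent (F t)) ->
    (forall u, pch_morphism (F^~ u)) -> (forall t, pch_morphism (F t)) ->
    (forall t u, basic t -> basic u -> derivably hnf (F t u)) ->
  forall t u, derivably hnf t -> derivably hnf u -> derivably hnf (F t u).
Proof.
move=> congFl congFr Fl_pch Fr_pch F_basic t u ht hu.
apply: (hnf_pch_morphism (congFl u)) ht => // {}t bt.
by apply: (hnf_pch_morphism (congFr t)) hu => // {}u; apply: F_basic.
Qed.

Lemma hnf_op_argument n (o : O n) x i :
    pch_morphism (fun u => op o (upd x i u)) ->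
    (forall t, basic t -> derivably hnf (op o (upd x i t))) ->
  derivably hnf (x i) -> derivably hnf (op o x).
Proof.
move=> op_pch op_basic; rewrite -{2}(upd_id x i); move: (x i).
apply: (hnf_pch_morphism (F := fun u => op o (upd x i u))) => // t u tu.
by apply: d_op => j; rewrite /upd; case: ifP => // _; apply: d_refl.
Qed.

Variable ga : commFun A.
Hypothesis pACP_Ax : subtheory (pACP_ax ga (O := O)) Ax.

Lemma derivable_pACP t u : pACP_ax ga noprem t u -> t === u.
Proof. by move/pACP_Ax; apply: derivable_ax. Qed.

Lemma derivable_altACA t t' u u' : (t + t') + (u + u') === (t + u) + (t' + u').
Proof.
have altA v v' w : (v + v') + w === v + (v' + w) by apply/derivable_pACP/A2.
have altC v w : v + w === w + v by apply/derivable_pACP/A1.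
apply: d_trans (altA _ _ _) _; apply: d_sym; apply: d_trans (altA _ _ _) _.
apply: d_alt (d_refl _ _) _; apply: d_trans (d_sym (altA _ _ _)) _.
by apply: d_trans (d_alt (altC _ _) (d_refl _ _)) _; apply: altA.
Qed.

Lemma basic_idem t : basic t -> t === t + t.
Proof.
elim=> {t} [a|a t|t u _ IHt _ IHu].
- exact/d_sym/derivable_pACP/A3'.
- apply/d_sym/(d_trans (d_sym (derivable_pACP (A4 _ _ _ _)))).
  by apply: d_seqc (d_refl _ _); apply/derivable_pACP/A3'.
- exact: d_trans (d_alt IHt IHu) (derivable_altACA _ _ _ _).
Qed.

Lemma idem_derivable (I : Type) (x : I -> T) :
  (forall i, basic (x i)) -> forall u v, idem x u v -> u === v.
Proof. by move=> bx _ _ [i [-> ->]]; apply: basic_idem. Qed.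

Lemma basic_prefix a t : derivably basic (act a * t).
Proof.
case: a => [a|]; first exact/derivably_refl/BasicPrefix.
by exists delta; [constructor | apply/derivable_pACP/A7].
Qed.

Lemma hnf_alt t u :
  derivably hnf t -> derivably hnf u -> derivably hnf (t + u).
Proof.
move: t u; apply: hnf_pch_bimorphism => [u t t'|t u u'|u p t t'|t p u u'|t u].
- by move=> tt'; apply: d_alt (d_refl _ _).
- by move=> uu'; apply: d_alt (d_refl _ _) _.
- exact/derivable_pACP/pA5.
- have altC v w : v + w === w + v by apply/derivable_pACP/A1.
  apply: d_trans (altC _ _) (d_trans _ (d_pch _ (altC _ _) (altC _ _))).
  exact/derivable_pACP/pA5.
- by move=> bt bu; apply/derivably_refl/HnfBasic/BasicAlt.
Qed.

Lemma hnf_seqc t u : derivably hnf t -> derivably hnf (t * u).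
Proof.
apply: (hnf_pch_morphism (F := seqc^~ u)) => [v w vw|p v w|v bv].
- exact: d_seqc (d_refl _ _).
- exact/derivable_pACP/pA4.
apply/hnf_basic; move: v bv.
apply: (basic_alt_morphism (F := seqc^~ u)) => [v w|a|a v].
- exact/derivable_pACP/A4.
- exact: basic_prefix.
- apply: derivably_trans (derivable_pACP (A5 _ _ _ _)) _.
  exact: basic_prefix.
Qed.

Lemma encap_act H a : exists b, encap H (act a) === act b.
Proof.
case: (classic (in_enc H a)) => Ha; last by exists a; apply/derivable_pACP/D1.
by exists None; apply/derivable_pACP/D2.
Qed.

Lemma hnf_encap H t : derivably hnf t -> derivably hnf (encap H t).
Proof.
apply: hnf_pch_morphism => {t} [t u|p t u|t bt].
- exact: d_encap.
- exact/derivable_pACP/pD.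
apply/hnf_basic; move: t bt; apply: basic_alt_morphism => [t u|a|a t].
- exact/derivable_pACP/D3.
- by have [b Hab] := encap_act H a; exists (act b); first constructor.
- have [b Hab] := encap_act H (Some a).
  apply: derivably_trans (derivable_pACP (D4 _ _ _ _)) _.
  by apply: derivably_trans (d_seqc Hab (d_refl _ _)) _; apply: basic_prefix.
Qed.

Lemma basic_lmerge t u : basic t -> derivably basic (t ||_ u).
Proof.
apply: (basic_alt_morphism (F := lmerge^~ u)) => {t} [t t'|a|a t].
- exact/derivable_pACP/CM4.
- apply: derivably_trans (derivable_pACP (CM2 _ _ _)) _.
  exact: basic_prefix.
- apply: derivably_trans (derivable_pACP (CM3 _ _ _ _)) _.
  exact: basic_prefix.
Qed.

Lemma hnf_lmerge t u : derivably hnf t -> derivably hnf (t ||_ u).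
Proof.
apply: (hnf_pch_morphism (F := lmerge^~ u)) => {t} [t t' tt'|p t t'|t bt].
- exact: d_lmerge (d_refl _ _).
- exact/derivable_pACP/pCM3.
- exact/hnf_basic/basic_lmerge.
Qed.

Lemma basic_cmerge t u : basic t -> basic u -> derivably basic (t |&| u).
Proof.
move=> bt bu; move: t bt; apply: (basic_alt_morphism (F := cmerge^~ u)).
- by move=> t t'; apply/derivable_pACP/CM8.
- move=> a; move: u bu; apply: basic_alt_morphism => [u u'|b|b u].
  + exact/derivable_pACP/CM9.
  + apply: derivably_trans (derivable_pACP (CM12 _ _ _ _ _)) _.
    exact/derivably_refl/BasicAct.
  + apply: derivably_trans (derivable_pACP (CM6 _ _ _ _)) _.
    exact: basic_prefix.
- move=> a t; move: u bu; apply: basic_alt_morphism => [u u'|b|b u].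
  + exact/derivable_pACP/CM9.
  + apply: derivably_trans (derivable_pACP (CM5 _ _ _ _)) _.
    exact: basic_prefix.
  + apply: derivably_trans (derivable_pACP (CM7 _ _ _ _ _)) _.
    exact: basic_prefix.
Qed.

Lemma hnf_cmerge t u :
  derivably hnf t -> derivably hnf u -> derivably hnf (t |&| u).
Proof.
move: t u; apply: hnf_pch_bimorphism => [u t t'|t u u'|u p t t'|t p u u'|t u].
- by move=> tt'; apply: d_cmerge (d_refl _ _).
- by move=> uu'; apply: d_cmerge (d_refl _ _) _.
- exact/derivable_pACP/pCM5.
- exact/derivable_pACP/pCM6.
- by move=> bt bu; apply/hnf_basic/basic_cmerge.
Qed.

Lemma basic_par t u : basic t -> basic u -> derivably basic (t ||| u).
Proof.
move=> bt bu.
have expansion : t ||| u === (t ||_ u + u ||_ t) + t |&| u.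
  by apply: d_ax (pACP_Ax (CM1' _ _ _)) (idem_derivable _) => [[]].
apply: derivably_trans expansion _; apply: basic_alt (basic_cmerge bt bu).
by apply: basic_alt; apply: basic_lmerge.
Qed.

Lemma hnf_par t u :
  derivably hnf t -> derivably hnf u -> derivably hnf (t ||| u).
Proof.
move: t u; apply: hnf_pch_bimorphism => [u t t'|t u u'|u p t t'|t p u u'|t u].
- by move=> tt'; apply: d_par (d_refl _ _).
- by move=> uu'; apply: d_par (d_refl _ _) _.
- exact/derivable_pACP/pCM1.
- exact/derivable_pACP/pCM2.
- by move=> bt bu; apply/hnf_basic/basic_par.
Qed.

Lemma hnf_of_unguarded_vars t :
    (forall n (o : O n) x, (forall i, derivably hnf (x i)) ->
      derivably hnf (op o x)) ->
    (forall Y, occurs Y false t -> derivably hnf (var Y)) ->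
  derivably hnf t.
Proof.
move=> op_hnf; elim: t => [Y|a|t IHt u IHu|t IHt u IHu|p t IHt u IHu
  |t IHt u IHu|t IHt u IHu|t IHt u IHu|H t IHt|n o x IHx] vars_hnf.
- by apply: vars_hnf; constructor.
- exact/derivably_refl/HnfBasic/BasicAct.
- by apply: hnf_alt; [apply: IHt|apply: IHu] => Y ?; apply: vars_hnf; constructor.
- by apply: hnf_seqc; apply: IHt => Y ?; apply: vars_hnf; constructor.
- by apply: hnf_pch; [apply: IHt|apply: IHu] => Y ?; apply: vars_hnf; constructor.
- by apply: hnf_par; [apply: IHt|apply: IHu] => Y ?; apply: vars_hnf; constructor.
- by apply: hnf_lmerge; apply: IHt => Y ?; apply: vars_hnf; constructor.
- by apply: hnf_cmerge; [apply: IHt|apply: IHu] => Y ?; apply: vars_hnf; constructor.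
- by apply: hnf_encap; apply: IHt => Y ?; apply: vars_hnf; constructor.
- apply: op_hnf => i; apply: IHx => Y ?.
  by apply: vars_hnf; econstructor; eassumption.
Qed.

End HeadNormalForms.

Arguments basic {M A O}.
Arguments hnf {M A O}.

Section StrategicInterleaving.
Variables (M : signedMeadow) (A : Type) (ga : commFun A) (st : strategy M ga).
Variables (O : nat -> Type) (emb : forall n, siop (cstate st) n -> O n).
Variable Ax : axioms M A O.
Hypothesis pACPpSI_Ax : subtheory (pACPpSI_ax emb) Ax.
Local Notation T := (term M A O).
Local Notation "t === u" := (derivable Ax t u) (at level 70).

Let pACP_Ax : subtheory (pACP_ax ga (O := O)) Ax.
Proof. by move=> P l r ax; apply: pACPpSI_Ax; left. Qed.

Lemma derivable_SI t u : SI_ax emb noprem t u -> t === u.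
Proof. by move=> ax; apply/derivable_ax/pACPpSI_Ax; right. Qed.

Lemma basic_SI_prefix t a u :
  SI_ax emb noprem t (act a * u) -> derivably Ax basic t.
Proof.
move=> /derivable_SI t_au; apply: derivably_trans t_au _.
exact: basic_prefix pACP_Ax _ _.
Qed.

Lemma plainVpcr a : plain st a \/ exists d : data st, a = pcr d.
Proof.
case: (classic (exists d : data st, a = pcr d)) => [|npcr]; first by right.
by left=> d ea; apply: npcr; exists d.
Qed.

Lemma basic_psi_act n (i : 'I_n.+1) (h : history n.+1) s (x : 'I_n.+1 -> T) a :
  derivably Ax basic (psi emb i h s (upd x i (act a))).
Proof.
case: a => [a|]; last first.
  by exists delta; [constructor | apply/derivable_SI/SI2].
case: (plainVpcr a) => [plain_a|[d ->]]; last exact/basic_SI_prefix/SI6.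
case: n i h x => [|n] i h x; last exact/basic_SI_prefix/SI4.
exists (actA a); first by constructor.
apply: d_trans (derivable_SI (SI3 emb i h s plain_a)).
by apply: d_op => j; rewrite /upd !ord1 eqxx; apply: d_refl.
Qed.

Lemma basic_psi_prefix n (i : 'I_n.+1) (h : history n.+1) s (x : 'I_n.+1 -> T)
    (a : A) t :
  derivably Ax basic (psi emb i h s (upd x i (actA a * t))).
Proof.
case: (plainVpcr a) => [plain_a|[d ->]]; first exact/basic_SI_prefix/SI5.
exact/basic_SI_prefix/SI7.
Qed.

Lemma basic_psi n (i : 'I_n.+1) (h : history n.+1) s (x : 'I_n.+1 -> T) t :
  basic t -> derivably Ax basic (psi emb i h s (upd x i t)).
Proof.
move: t; apply: basic_alt_morphism => [t u|a|a t].
- exact/derivable_SI/SI8.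
- exact: basic_psi_act.
- exact: basic_psi_prefix.
Qed.

Lemma hnf_psi n (i : 'I_n.+1) (h : history n.+1) s (x : 'I_n.+1 -> T) :
  derivably Ax hnf (x i) -> derivably Ax hnf (psi emb i h s x).
Proof.
apply: hnf_op_argument => [p t u|t bt].
- exact/derivable_SI/pSI2.
- exact/hnf_basic/basic_psi.
Qed.

Section Interleaving.
Variables (n : nat) (h : history n.+1) (s : cstate st).
Implicit Types x : 'I_n.+1 -> T.

Lemma hnf_si_basic x : (forall i, basic (x i)) ->
  derivably Ax hnf (si emb h s x).
Proof.
move=> bx; have idx := idem_derivable pACP_Ax bx.
case sched_hs: (sched h s) => [w|].
  have si_def := pACPpSI_Ax (or_intror (SI1' emb x sched_hs)).
  apply: derivably_trans (d_ax si_def idx) _; apply: hnf_bigpch => i.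
  exact/hnf_psi/derivably_refl/HnfBasic.
have si_undef := pACPpSI_Ax (or_intror (SI0' emb x sched_hs)).
by exists delta; [do 2 constructor | apply: d_ax si_undef idx].
Qed.

Lemma hnf_si x : (forall i, derivably Ax hnf (x i)) ->
  derivably Ax hnf (si emb h s x).
Proof.
suff si_nonbasic_in (r : seq 'I_n.+1) y : (forall i, derivably Ax hnf (y i)) ->
    (forall i, i \notin r -> basic (y i)) -> derivably Ax hnf (si emb h s y).
  move=> hx; apply: (si_nonbasic_in (enum 'I_n.+1)) => // i.
  by rewrite mem_enum.
elim: r y => [|i r IHr] {}x hx bx; first by apply: hnf_si_basic => i; apply: bx.
apply: hnf_op_argument (hx i) => [p t u|t bt]; first exact/derivable_SI/pSI1.
apply: IHr => j; rewrite /upd; case: eqP => //.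
  by move=> _; apply/derivably_refl/HnfBasic.
by move=> /eqP ji jr; apply: bx; rewrite inE negb_or ji.
Qed.

End Interleaving.

Lemma hnf_siop n (o : siop (cstate st) n) x :
  (forall i, derivably Ax hnf (x i)) ->
  derivably Ax hnf (op (emb o) x).
Proof.
by case: o x => [m h s|m i h s] x hx; [apply: hnf_si | apply: hnf_psi].
Qed.

End StrategicInterleaving.

Section Abstraction.
Variables (M : signedMeadow) (A : Type) (O : nat -> Type).
Local Notation T := (term M A O).
Implicit Types t u : T.

Fixpoint continuations t : seq T :=
  match t with
  | act (Some _) * u => [:: u]
  | u + v | u <+{_} v => (continuations u ++ continuations v)%list
  | _ => [::]
  end.

Lemma occurs_act Y b a : ~ occurs Y b (act a : T).
Proof. by move=> oY; inversion oY. Qed.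

Lemma guarded_act a : guarded (act a : T).
Proof. by move=> Y b /occurs_act. Qed.

Lemma guarded_prefix (a : A) t : guarded (actA a * t).
Proof.
by move=> Y b oY; inversion oY; subst=> //; case: (@occurs_act Y b (Some a)).
Qed.

Lemma guarded_alt t u : guarded t -> guarded u -> guarded (t + u).
Proof.
by move=> gt gu Y b oY; inversion oY; subst; [apply: (gt Y)|apply: (gu Y)].
Qed.

Lemma guarded_pch p t u : guarded t -> guarded u -> guarded (t <+{p} u).
Proof.
by move=> gt gu Y b oY; inversion oY; subst; [apply: (gt Y)|apply: (gu Y)].
Qed.

End Abstraction.

Section Solutions.
Variables (M : signedMeadow) (A : Type) (O : nat -> Type).
Local Notation T := (term M A O).
Local Notation pACP_interp := (interp (M := M) (A := A) (@noopE O)).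

Lemma hnf_abstraction (sg : nat -> T) t : hnf t ->
    List.Forall (fun u => exists Y, sg Y = u) (continuations t) ->
  exists2 v, guarded v & t = pACP_interp sg v.
Proof.
elim=> {t} [t|p t u _ IHt _ IHu]; last first.
  move=> /List.Forall_app [/IHt [v gv ->] /IHu [w gw ->]].
  by exists (v <+{p} w); first exact: guarded_pch.
elim=> {t} [a|a t|t u _ IHt _ IHu].
- by exists (act a); first exact: guarded_act.
- move=> /List.Forall_cons_iff [[Y <-] _].
  by exists (actA a * var Y); first exact: guarded_prefix.
- move=> /List.Forall_app [/IHt [v gv ->] /IHu [w gw ->]].
  by exists (v + w); first exact: guarded_alt.
Qed.

Lemma guarded_pACP_solution (Ax : axioms M A O) (X : nat) (t : T) :
    (forall u, derivably Ax hnf u) ->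
  exists (sg : nat -> T) (body : nat -> term M A noop),
    [/\ sg X = t, forall Y, guarded (body Y) &
        forall Y, derivable Ax (sg Y) (pACP_interp sg (body Y))].
Proof.
move=> all_hnf; have nf_exists u : exists v, hnf v /\ derivable Ax u v.
  by have [v] := all_hnf u; exists v.
have [nf nfP] := functional_choice _ nf_exists.
pose next u n := List.nth n (continuations (nf u)) delta.
have [sg sgX sg_next] := enumerate_reachable next X t.
have body_exists Y : exists v, guarded v /\ derivable Ax (sg Y) (pACP_interp sg v).
  have [hnf_sgY sgY_nf] := nfP (sg Y).
  have [|v gv nfE] := hnf_abstraction (sg := sg) hnf_sgY; last first.
    by exists v; rewrite -nfE.
  apply/List.Forall_forall => u u_cont.
  have [n [_ <-]] := List.In_nth _ _ delta u_cont.
  exact: sg_next.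
have [body bodyP] := functional_choice _ body_exists.
by exists sg, body; split=> // Y; case: (bodyP Y).
Qed.

End Solutions.

Section Specification.
Variables (M : signedMeadow) (A : Type) (ga : commFun A) (st : strategy M ga).
Variables (E : pSI_spec st) (gE : pSI_guarded E).
Local Notation T := (term M A (siop (cstate st))).

(* The case [E Y = None] matters: rewriting a right-hand side of [E] may introduce
   variables that [E] does not define. *)
Inductive unfold_ax : axioms M A (siop (cstate st)) :=
| Unfold Y : unfold_ax noprem (var Y) (odflt delta (E Y)).

Definition spec_ax : axioms M A (siop (cstate st)) :=
  fun P l r => pACPpSI_ax (st := st) (fun n o => o) P l r \/ unfold_ax P l r.

Lemma pACPpSI_spec_ax : subtheory (pACPpSI_ax (st := st) (fun n o => o)) spec_ax.
Proof. by left. Qed.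

Lemma pACP_spec_ax : subtheory (pACP_ax ga (O := siop (cstate st))) spec_ax.
Proof. by move=> P l r ax; left; left. Qed.

Lemma derivable_unfold Y : derivable spec_ax (var Y) (odflt delta (E Y)).
Proof. by apply: derivable_ax; right. Qed.

Lemma hnf_spec_op n (o : siop (cstate st) n) x :
  (forall i, derivably spec_ax hnf (x i)) -> derivably spec_ax hnf (op o x).
Proof. exact: (hnf_siop pACPpSI_spec_ax). Qed.

Lemma hnf_spec_var Y : derivably spec_ax hnf (var Y).
Proof.
apply: derivably_trans (derivable_unfold Y) _.
case EY: (E Y) => [t|] /=; last by apply/derivably_refl/HnfBasic/BasicAct.
have [u rewr_tu gu] := gE.2 _ _ EY.
have tu : derivable spec_ax t u.
  apply: rewrites_derivable pACPpSI_spec_ax _ rewr_tu => Z v EZ.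
  by have := derivable_unfold Z; rewrite EZ.
apply: derivably_trans tu _; apply: (hnf_of_unguarded_vars pACP_spec_ax).
  exact: hnf_spec_op.
by move=> Z /gu.
Qed.

Lemma hnf_spec (t : T) : derivably spec_ax hnf t.
Proof.
apply: (hnf_of_unguarded_vars pACP_spec_ax); first exact: hnf_spec_op.
by move=> Y _; apply: hnf_spec_var.
Qed.

Lemma rec_subst_var Y (vY : vars E Y) : rec_subst gE (var Y) = rec_term gE vY.
Proof.
rewrite /rec_subst /=; move: (erefl (vars E Y)); move: {2 3}(vars E Y) => b e.
by case: b e => e; [rewrite (eq_irrelevance e vY) | rewrite vY in e].
Qed.

Definition rec_solution Y : term M A (sirop st) :=
  if E Y is Some _ then rec_subst gE (var Y) else delta.

Lemma rec_solution_vars Y : vars E Y -> rec_solution Y = rec_subst gE (var Y).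
Proof. by rewrite /vars /rec_solution; case: (E Y). Qed.

Local Notation closure := (interp (@SIRop M A ga st) rec_solution).

Lemma closure_var Y (vY : vars E Y) : closure (var Y) = rec_term gE vY.
Proof. by rewrite -rec_subst_var -rec_solution_vars. Qed.

Lemma rec_subst_closure t : (forall Y b, occurs Y b t -> vars E Y) ->
  rec_subst gE t = closure t.
Proof.
move=> vars_t; apply: (eq_in_interp (@SIRop M A ga st)) => Y b /vars_t vY.
by rewrite (rec_solution_vars vY).
Qed.

Lemma interprets_unfold :
  interprets (@SIRop M A ga st) rec_solution (pACPpSIr_ax (st := st)) unfold_ax.
Proof.
move=> _ _ _ [Y] _; case EY: (E Y) => [t|] /=; last first.
  by rewrite /interp /= /rec_solution EY; apply: d_refl.
have vY : vars E Y by rewrite /vars EY.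
rewrite (closure_var vY) -rec_subst_closure; last exact: (gE.1 _ _ EY).
by apply: derivable_ax; right; apply: RDP EY.
Qed.

Lemma derivable_closure t u :
  derivable spec_ax t u -> derivable (pACPpSIr_ax (st := st)) (closure t) (closure u).
Proof.
apply: derivable_interp => P l r [[ax|ax]|ax].
- by apply: interprets_pACP ax => Q l' r' ax'; left; left.
- by apply: interprets_SI ax => Q l' r' ax'; left; right.
- exact: interprets_unfold.
Qed.

End Specification.

Theorem theorem4 (M : signedMeadow) (A : Type) (ga : commFun A)
    (st : strategy M ga) (E : pSI_spec st) (gE : pSI_guarded E)
    (X : nat) (vX : vars E X) :
  exists (E' : pACP_spec M A) (gE' : pACP_guarded ga E') (vX' : vars E' X),
    derivable (pACPpSIr_ax (st := st))
      (rec_term gE vX)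
      (rec_term (embed_guarded st gE') (vars_embed st vX')).
Proof.
have [sg [body [sgX g_body sg_body]]] :=
  guarded_pACP_solution X (var X) (hnf_spec gE).
pose E' : pACP_spec M A := fun Y => Some (body Y).
have gE' : pACP_guarded ga E'.
  by split=> // Y _ [<-]; exists (body Y) => //; apply/rw_ax/d_refl.
have vX' : vars E' X by [].
exists E', gE', vX'.
pose sg' Y := interp (@SIRop M A ga st) (rec_solution gE) (sg Y).
have -> : rec_term gE vX = sg' X by rewrite /sg' sgX closure_var.
apply: d_ax; first by right; apply: (RSP _ _ sg').
move=> _ _ [Y [_ [[<-] -> ->]]].
have := derivable_closure gE (sg_body Y).
by rewrite [X in derivable _ _ X]interp_tsubst.
Qed.
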